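(* Let $k\ge 2$, let $n_1<n_2<\cdots<n_k$ be positive integers with $\gcd(n_1,\ldots,n_k)=1$, and let $S=\langle n_1,\ldots,n_k\rangle$. Let $d$, $A_i$ ($0\le i<n_1$), $A'_{i'}$ ($0\le i'<n_k$), $\mathsf L(n)$, $\mathsf M(n)$ and $\mathsf m(n)$ be as defined in the context. Then for every $n\in S$ with $n\ge n_k^2-n_1^2$, if $i\in\{0,\ldots,n_1-1\}$ and $i'\in\{0,\ldots,n_k-1\}$ are given by $n\equiv i \bmod n_1$ and $n\equiv i' \bmod n_k$, then $$\mathsf L(n)=\{\mathsf m(n),\,\mathsf m(n)+d,\,\ldots,\,\mathsf M(n)-d,\,\mathsf M(n)\}\setminus\big((dA'_{i'}+\mathsf m(n))\cup(-dA_i+\mathsf M(n))\big).$$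
   Context: For positive integers $g_1,\ldots,g_r$, $\langle g_1,\ldots,g_r\rangle=\{q_1g_1+\cdots+q_rg_r : q_j\in\mathbb Z_{\ge 0}\}$. The generators $n_1,\ldots,n_k$ of $S$ are fixed and need not be a minimal generating set. For $n\in S$, the length set is $\mathsf L(n)=\{q_1+\cdots+q_k : q_1,\ldots,q_k\in\mathbb Z_{\ge 0},\ n=q_1n_1+\cdots+q_kn_k\}$, and $\mathsf M(n)=\max\mathsf L(n)$, $\mathsf m(n)=\min \mathsf L(n)$. Let $S_{\mathsf M}=\langle n_2-n_1,n_3-n_1,\ldots,n_k-n_1\rangle$ and $S_{\mathsf m}=\langle n_k-n_1,n_k-n_2,\ldots,n_k-n_{k-1}\rangle$, and let $d=\gcd(S_{\mathsf M})=\gcd(S_{\mathsf m})$ (these two gcds are equal). Since $\gcd(d,n_1)=\gcd(d,n_k)=1$, $S_{\mathsf M}$ meets every residue class modulo $n_1$ and $S_{\mathsf m}$ meets every residue class modulo $n_k$. For $0\le i<n_1$ let $b_{i1}$ be the smallest element of $S_{\mathsf M}$ congruent to $i$ modulo $n_1$, and let $A_i=\{r\in\mathbb Z_{\ge 1} : b_{i1}+r\,d\,n_1\notin S_{\mathsf M}\}$. For $0\le i'<n_k$ let $c_{i'1}$ be the smallest element of $S_{\mathsf m}$ with $c_{i'1}+i'\equiv 0\bmod n_k$, and let $A'_{i'}=\{r'\in\mathbb Z_{\ge 1} : c_{i'1}+r'\,d\,n_k\notin S_{\mathsf m}\}$. For a set $A$ of integers and an integer $m$, $dA+m=\{da+m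 : a\in A\}$ and $-dA+m=\{-da+m : a\in A\}$. The set $\{\mathsf m(n),\mathsf m(n)+d,\ldots,\mathsf M(n)\}$ is the arithmetic progression with step $d$ from $\mathsf m(n)$ to $\mathsf M(n)$ (note $d\mid \mathsf M(n)-\mathsf m(n)$). *)

(* Defs.v *)
From mathcomp Require Import all_boot all_order all_algebra.
From mathcomp Require Import boolp classical_sets.

Set Implicit Arguments.
Unset Strict Implicit.
Unset Printing Implicit Defensive.

Local Open Scope classical_set_scope.

(* xget 0 P returns an element of P if there is one and 0 otherwise; the sets
   below have at most one element, so the default 0 is only used when the
   extremum (or gcd) does not exist. *)
Definition set_min (A : set nat) : nat := xget 0 (A `&` lbound A).

Definition set_max (A : set nat) : nat := xget 0 (A `&` ubound A).

Definition set_gcd (A : set nat) : nat :=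
  xget 0 [set d | (forall x, A x -> d %| x) /\
                  (forall e, (forall x, A x -> e %| x) -> e %| d)].

Definition factorization (gs : seq nat) (n : nat) :
    set ('I_(size gs) -> nat) :=
  [set q | n = \sum_(j < size gs) q j * nth 0 gs j].

Definition monoid_gen (gs : seq nat) : set nat :=
  [set n | exists q, factorization (gs := gs) n q].

Definition length_set (gs : seq nat) (n : nat) : set nat :=
  [set \sum_(j < size gs) q j | q in factorization (gs := gs) n].

Definition max_length (gs : seq nat) (n : nat) : nat :=
  set_max (length_set gs n).

Definition min_length (gs : seq nat) (n : nat) : nat :=
  set_min (length_set gs n).

(* Below, gs = [:: n_1; ...; n_k] is strictly increasing, so the subtractions
   of natural numbers are not truncated. *)
Definition gen_first (gs : seq nat) : nat := head 0 gs.

Definition gen_last (gs : seq nat) : nat := last 0 gs.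

Definition S_M (gs : seq nat) : set nat :=
  monoid_gen [seq x - gen_first gs | x <- behead gs].

Definition S_m (gs : seq nat) : set nat :=
  monoid_gen [seq gen_last gs - x | x <- take (size gs).-1 gs].

(* S_m gs has the same gcd. *)
Definition step (gs : seq nat) : nat := set_gcd (S_M gs).

Definition b1 (gs : seq nat) (i : nat) : nat :=
  set_min (S_M gs `&` [set x | x = i %[mod gen_first gs]]).

Definition A_ (gs : seq nat) (i : nat) : set nat :=
  [set r | 1 <= r /\ ~ S_M gs (b1 gs i + r * step gs * gen_first gs)].

Definition c1 (gs : seq nat) (i' : nat) : nat :=
  set_min (S_m gs `&` [set x | x + i' = 0 %[mod gen_last gs]]).

Definition A'_ (gs : seq nat) (i' : nat) : set nat :=
  [set r' | 1 <= r' /\ ~ S_m gs (c1 gs i' + r' * step gs * gen_last gs)].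

Local Open Scope ring_scope.

(* Sets of lengths are compared in int: - d A + M may contain negative
   integers, which truncated subtraction would send to 0. *)
Definition affine_image (e : int) (A : set nat) (m : int) : set int :=
  [set e * a%:Z + m | a in A].

Definition arith_progression (m d M : int) : set int :=
  [set x | (exists j : nat, x = m + j%:Z * d) /\ x <= M].

(* Main.v *)
Require Import Defs.
From mathcomp Require Import all_boot all_order all_algebra.
From mathcomp Require Import boolp classical_sets.
From mathcomp Require Import zify.

Set Implicit Arguments.
Unset Strict Implicit.
Unset Printing Implicit Defensive.

(* Write a = n_1, b = n_k, D = b - a. A factorization of n of length l amounts to
   a sum of at most l elements y - a equal to x = n - l a, and also to a sum of
   at most l elements b - y equal to y = l b - n. By the pigeonhole principle,
   sums in S_M or S_m need fewer than D summands other than D; since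
   b x + a y = D n >= D^2 (a + b), one of x, y is at least D^2, and so for such n,
   l is a length of n iff n - l a lies in S_M and l b - n lies in S_m.
   It remains to see that the extremal l allowed by S_M alone, or by S_m alone,
   are attained, i.e. that n - M a and m b - n are the least elements of their
   classes. A single list T of fewer than D / d differences y - a reaches all
   multiples of d mod D, which gives thresholds W, V with W + V <= D (D / d - 1)
   beyond which S_M and S_m contain every multiple of d; failure would put both
   coordinates below these thresholds up to d a and d b, against b x + a y = D n. *)

(** * Factorizations as lists of generators *)

(** Lists with repetition replace coefficient vectors, so that blocks of summands can be cut out and
    sublists selected. *)
Definition seq_span (H : seq nat) (x : nat) : Prop :=
  exists2 s : seq nat, {subset s <= H} & sumn s = x.

Lemma subset_cat (s1 s2 H : seq nat) :
  {subset s1 <= H} -> {subset s2 <= H} -> {subset s1 ++ s2 <= H}.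
Proof. by move=> h1 h2 y; rewrite mem_cat => /orP[/h1|/h2]. Qed.

Lemma subset_nseq (c q : nat) (H : seq nat) :
  c \in H -> {subset nseq q c <= H}.
Proof. by move=> cH y; rewrite mem_nseq => /andP[_ /eqP->]. Qed.

(** A coefficient vector unrolls into copies of the generators; conversely each list entry raises
    the coefficient at its first index in [gs]. *)
Lemma length_setP (gs : seq nat) (n l : nat) :
  length_set gs n l <->
  exists s : seq nat, [/\ {subset s <= gs}, size s = l & sumn s = n].
Proof.
split=> [[q hq <-]|[s [hs <- <-]]].
  exists (flatten [seq nseq (q j) (nth 0 gs j) | j <- enum 'I_(size gs)]).
  split.
  - move=> y /flattenP[t /mapP[j _ ->]]; rewrite mem_nseq => /andP[_ /eqP->].
    exact: mem_nth.
  - rewrite size_flatten /shape -map_comp sumnE big_map enumT.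
    by apply: eq_bigr => j _ /=; rewrite size_nseq.
  - rewrite hq sumn_flatten -map_comp sumnE big_map enumT.
    by apply: eq_bigr => j _ /=; rewrite sumn_nseq mulnC.
elim: s hs => [_|y s IH hs].
  exists (fun=> 0); first by rewrite /factorization /= big1.
  by rewrite big1.
have [|q hq Eq] := IH; first by move=> z zs; apply: hs; rewrite inE zs orbT.
have yg : index y gs < size gs by rewrite index_mem; apply: hs; rewrite mem_head.
pose j0 := Ordinal yg.
exists (fun j => (j == j0) + q j).
  rewrite /factorization /= hq; under eq_bigr do rewrite mulnDl.
  rewrite big_split /=; congr addn.
  rewrite (bigD1 j0) //= eqxx mul1n nth_index -?index_mem //.
  by rewrite big1 ?addn0 // => j /negbTE->.
rewrite big_split /= Eq (bigD1 j0) //= eqxx big1 // => j /negbTE-> //.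
Qed.

Lemma monoid_genP (gs : seq nat) (n : nat) :
  monoid_gen gs n <-> seq_span gs n.
Proof.
split=> [[q hq]|[s hs <-]].
  have /length_setP[s [hs _ <-]] : length_set gs n (\sum_j q j) by exists q.
  by exists s.
have [|q hq _] := (length_setP gs (sumn s) (size s)).2; last by exists q.
by exists s.
Qed.

(** * Bounding the number of summands by pigeonhole *)

(* A block of consecutive elements whose sum vanishes mod D: two of the
   prefix sums agree mod D. *)
Lemma zero_sum_block (D : nat) (s : seq nat) : 0 < D -> D <= size s ->
  exists s1 m s2, [/\ s = s1 ++ m ++ s2, 0 < size m & D %| sumn m].
Proof.
move=> D0 hs.
pose f i := sumn (take i s) %% D.
have /(uniqPn 0)[i [j []]] : ~~ uniq [seq f i | i <- iota 0 (size s).+1].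
  apply/negP => /uniq_leq_size sub.
  have : size [seq f i | i <- iota 0 (size s).+1] <= size (iota 0 D).
    by apply: sub => _ /mapP[k _ ->]; rewrite mem_iota add0n ltn_mod.
  by rewrite size_map !size_iota ltnNge hs.
rewrite size_map size_iota => ij js.
rewrite !(nth_map 0) ?size_iota ?nth_iota ?add0n //; try lia.
rewrite /f => Ef.
exists (take i s), (take (j - i) (drop i s)), (drop j s).
have E : take j s = take i s ++ take (j - i) (drop i s).
  by rewrite -takeD subnKC // ltnW.
split; first by rewrite catA -E cat_take_drop.
  by rewrite size_takel ?size_drop; lia.
have /eqP := Ef; rewrite [in X in _ == X]E sumn_cat.
by rewrite -{1}[sumn _]addn0 eqn_modDl mod0n eq_sym.
Qed.

(** While the list has at least [D] entries, a block whose sum is a multiple of [D] can be cut out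
    and that multiple counted in [q]. *)
Lemma few_small_summands (D : nat) (H s : seq nat) :
  0 < D -> {subset s <= H} ->
  exists t q, [/\ {subset t <= H}, size t < D & sumn t + q * D = sumn s].
Proof.
move=> D0; have [N] := ubnP (size s); elim: N s => // N IH s sN hs.
have [hlt|hge] := ltnP (size s) D; first by exists s, 0; rewrite addn0.
have [s1 [m [s2 [Es m0 /dvdnP[c Ec]]]]] := zero_sum_block D0 hge.
have [||t [q [ht tD Et]]] := IH (s1 ++ s2).
- by move: sN; rewrite Es !size_cat; lia.
- by move=> y hy; apply: hs; move: hy; rewrite Es !mem_cat => /orP[]->; rewrite ?orbT.
exists t, (q + c); split => //.
by move: Et; rewrite Es !sumn_cat Ec; lia.
Qed.

(** With at most [D - 1] entries in [t] and [q * D <= x], the count [size t + q] is at most [l];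
    zeros fill it up to exactly [l]. *)
Lemma span_of_length (D l x : nat) (H : seq nat) :
  0 < D -> 0 \in H -> D \in H -> seq_span H x -> x + D * D.-1 <= l * D ->
  exists s : seq nat, [/\ {subset s <= H}, size s = l & sumn s = x].
Proof.
move=> D0 H0 HD [s hs <-] hl.
have [t [q [ht tD Et]]] := few_small_summands D0 hs.
have tql : size t + q <= l.
  rewrite -(leq_pmul2r D0) mulnDl (leq_trans _ hl) // addnC.
  apply: leq_add; first by rewrite -Et leq_addl.
  by rewrite mulnC leq_pmul2l // -ltnS prednK.
exists (t ++ nseq q D ++ nseq (l - (size t + q)) 0); split.
- by do 2![apply: subset_cat => //]; apply: subset_nseq.
- by rewrite !size_cat !size_nseq addnA subnKC.
- by rewrite !sumn_cat !sumn_nseq mul0n addn0 -Et mulnC.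
Qed.

(** * Residues modulo [D] reached by few summands *)

Lemma dvd_foldr_gcdn (H : seq nat) (y : nat) : y \in H -> foldr gcdn 0 H %| y.
Proof.
elim: H => //= h H IH; rewrite inE => /orP[/eqP->|/IH]; first exact: dvdn_gcdl.
by apply: dvdn_trans; exact: dvdn_gcdr.
Qed.

Lemma dvd_seq_span (H : seq nat) (d x : nat) :
  (forall y, y \in H -> d %| y) -> seq_span H x -> d %| x.
Proof.
move=> dH [s hs <-]; elim: s hs => [|y s IH] hs; first exact: dvdn0.
apply: dvdn_add; first by apply/dH/hs/mem_head.
by apply: IH => z zs; rewrite hs // inE zs orbT.
Qed.

(** Each entry of [T] is used at most once, so the sums involved never exceed [sumn T]; this later
    bounds the thresholds. *)
Definition reach (D : nat) (T : seq nat) : {set 'I_D} :=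
  [set i : 'I_D | `[< exists2 s, subseq s T & sumn s = i %[mod D] >]].

Lemma mem_reach (D : nat) (T : seq nat) (i : 'I_D) :
  i \in reach D T <-> exists2 s, subseq s T & sumn s = i %[mod D].
Proof. by rewrite inE; split=> /asboolP. Qed.

(** Bezout with nonnegative coefficients: modulo [D], the negative term [- u * y] is replaced by
    [u * D.-1 * y]. *)
Lemma span_gcd_mod (D : nat) (H : seq nat) (x : nat) : 0 < D ->
  foldr gcdn 0 H %| x -> exists2 y, seq_span H y & y = x %[mod D].
Proof.
move=> D0 /dvdnP[c ->].
have mulS (G : seq nat) z k : seq_span G z -> seq_span G (k * z).
  case=> s hs <-; elim: k => [|k [t ht Et]]; first by exists [::].
  by exists (s ++ t); [exact: subset_cat | rewrite sumn_cat Et mulSn].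
suff [y hy Ey] : exists2 y, seq_span H y & y = foldr gcdn 0 H %[mod D].
  by exists (c * y); [exact: mulS | rewrite -modnMmr Ey modnMmr].
elim: H => [|h H [y [s hs Es] Ey]] /=; first by exists 0 => //; exists [::].
set g := foldr gcdn 0 H in Ey *.
have hsub (t : seq nat) : {subset t <= H} -> {subset t <= h :: H}.
  by move=> ht z /ht; rewrite inE orbC => ->.
have [->|h0] := posnP h.
  by rewrite gcd0n; exists y => //; exists s => // z /hs; rewrite inE orbC => ->.
have [u _ /dvdnP[k Ek]] := Bezoutl g h0.
have [t ht Et] : seq_span (h :: H) (u * D.-1 * y).
  by apply: mulS; exists s => //; exact: hsub.
exists (k * h + u * D.-1 * y).
  exists (nseq k h ++ t); last by rewrite sumn_cat sumn_nseq Et mulnC.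
  by apply: subset_cat => //; apply: subset_nseq; rewrite mem_head.
rewrite -Ek -modnDmr -modnMmr Ey modnMmr modnDmr.
rewrite -addnA -mulnA -mulnDr -mulSn prednK //.
by rewrite mulnCA mulnC addnC modnMDl.
Qed.

(* A list that cannot be lengthened profitably reaches a set of residues closed
   under adding elements of H; before that, each new element adds a residue. *)
Lemma reaching_list (D e : nat) (H : seq nat) : 0 < D -> 0 < e ->
  D = e * foldr gcdn 0 H ->
  exists T : seq nat, [/\ {subset T <= H}, size T < e &
    forall x, foldr gcdn 0 H %| x ->
      exists2 s, subseq s T & sumn s = x %[mod D]].
Proof.
set d := foldr gcdn 0 H => D0 e0 ED.
have d0 : 0 < d by move: D0; rewrite ED muln_gt0 => /andP[].
have dsum (s : seq nat) : {subset s <= H} -> d %| sumn s.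
  by move=> hs; apply: (@dvd_seq_span H) => [y|]; [exact: dvd_foldr_gcdn|exists s].
have dD : d %| D by rewrite ED dvdn_mull.
(* All sums are multiples of [d], and these have only [e] residues modulo [D = e * d]. *)
have card_reach (T : seq nat) : {subset T <= H} -> #|reach D T| <= e.
  move=> TH; pose f (j : 'I_e) : 'I_D := insubd (Ordinal D0) (j * d).
  apply: leq_trans (_ : #|f @: 'I_e| <= _); last first.
    by rewrite (leq_trans (leq_imset_card _ _)) // card_ord.
  apply: subset_leq_card; apply/fintype.subsetP => i /mem_reach[s sT Es].
  have /dvdnP[q Eq] : d %| i.
    have : d %| i %% D.
      by rewrite -Es /dvdn modn_dvdm // -/(dvdn d _) dsum // => z /(mem_subseq sT) /TH.
    by rewrite modn_small.
  have qe : q < e by rewrite -(ltn_pmul2r d0) -Eq -ED.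
  apply/imsetP; exists (Ordinal qe) => //; apply: val_inj.
  by rewrite /f val_insubd /= -Eq ltn_ord.
have reachS T t : reach D T \subset reach D (t :: T).
  apply/fintype.subsetP => i /mem_reach[s sT Es]; apply/mem_reach; exists s => //.
  exact: subseq_trans sT (subseq_cons _ _).
pose complete T := forall t, t \in H -> reach D (t :: T) = reach D T.
have [T [TH Te TC]] : exists T : seq nat,
    [/\ {subset T <= H}, size T < e & complete T].
  (* Greedy growth. For [m = e - 1] the second alternative says that all [e] possible residues are
     reached, which forces completeness too. *)
  suff step m : m < e -> exists T : seq nat,
      [/\ {subset T <= H}, size T <= m & complete T \/ m < #|reach D T|].
    have [|T [TH Tm [TC|cT]]] := step e.-1; first by rewrite prednK.
      by exists T; split => //; rewrite -ltnS prednK in Tm *.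
    exists T; split => //; first by rewrite -ltnS prednK in Tm.
    move=> t tH; apply/eqP; rewrite eq_sym eqEcard reachS /=.
    rewrite (leq_trans (card_reach (t :: T) _)) //; last by rewrite prednK in cT.
    by move=> y; rewrite inE => /orP[/eqP->|/TH].
  elim: m => [_|m IH me].
    exists [::]; split => //; right; apply/card_gt0P; exists (Ordinal D0).
    by apply/mem_reach; exists [::].
  have [|T [TH Tm [TC|cT]]] := IH; first exact: ltnW.
    by exists T; split => //; [exact: leqW | left].
  have [[t [tH nt]]|TC] := pselect (exists t, t \in H /\ reach D (t :: T) <> reach D T).
    exists (t :: T); split => //.
      by move=> y; rewrite inE => /orP[/eqP->|/TH].
    right; apply: leq_ltn_trans cT (proper_card _).
    by rewrite finset.properEneq reachS andbT eq_sym; apply/eqP.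
  exists T; split => //; first exact: leqW.
  by left=> t tH; apply: contrapT => nt; apply: TC; exists t.
exists T; split => // x dx.
(* It suffices to reach sums over [H]; they are built one summand at a time, and completeness keeps
   each residue in [reach D T]. *)
have [_ [s sH <-] <-] := span_gcd_mod D0 dx.
have mD y : y %% D < D by rewrite ltn_mod.
suff /mem_reach[s' s'T E] : Ordinal (mD (sumn s)) \in reach D T.
  by exists s' => //; rewrite E /= modn_mod.
elim: s sH => [_|t s IH sH] /=.
  by apply/mem_reach; exists [::]; rewrite ?sub0seq //= modn_mod.
have /mem_reach[s' s'T E] : Ordinal (mD (sumn s)) \in reach D T.
  by apply: IH => y ys; rewrite sH // inE ys orbT.
rewrite -(TC t) ?sH ?mem_head //; apply/mem_reach; exists (t :: s').
  by rewrite /= eqxx.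
by rewrite /= -modnDmr E /= !modn_mod modnDmr.
Qed.

(** * Lengths in terms of differences and codifferences *)

(** The generator [a] is not removed, as it is in [S_M]: its difference 0 pads a sum to a prescribed
    number of summands. *)
Definition diffs (a : nat) (gs : seq nat) := [seq y - a | y <- gs].

Definition codiffs (b : nat) (gs : seq nat) := [seq b - y | y <- gs].

Lemma sumn_subseq (s t : seq nat) : subseq s t -> sumn s <= sumn t.
Proof.
case/subseqP=> m _ ->; elim: t m => [|y t IH] [|[] m] //=.
  by rewrite leq_add2l.
by rewrite (leq_trans (IH m)) ?leq_addl.
Qed.

Definition spans_interval (gs : seq nat) (a b : nat) : Prop :=
  [/\ a \in gs, b \in gs & forall y, y \in gs -> a <= y <= b].

Lemma subset_map_lift (f : nat -> nat) (gs s : seq nat) :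
  {subset s <= [seq f y | y <- gs]} ->
  exists2 t : seq nat, {subset t <= gs} & s = [seq f y | y <- t].
Proof.
elim: s => [_|z s IH hs]; first by exists [::].
have [|t ht Et] := IH; first by move=> w ws; rewrite hs // inE ws orbT.
have /mapP[y yg Ey] := hs z (mem_head _ _).
exists (y :: t); last by rewrite /= -Ey Et.
by move=> w; rewrite inE => /orP[/eqP->|/ht].
Qed.

Lemma subset_map_image (f : nat -> nat) (gs t : seq nat) :
  {subset t <= gs} -> {subset [seq f y | y <- t] <= [seq f y | y <- gs]}.
Proof. by move=> ht _ /mapP[y /ht yg ->]; exact: map_f. Qed.

Lemma sumn_diffs (a : nat) (t : seq nat) : {in t, forall y, a <= y} ->
  sumn (diffs a t) + size t * a = sumn t.
Proof.
elim: t => [_|y t IH] //= ht; rewrite -IH ?mulSn; last first.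
  by move=> z zt; apply: ht; rewrite inE zt orbT.
by have := ht y (mem_head _ _); lia.
Qed.

Lemma sumn_codiffs (b : nat) (t : seq nat) : {in t, forall y, y <= b} ->
  sumn (codiffs b t) + sumn t = size t * b.
Proof.
elim: t => [_|y t IH] //= ht; rewrite mulSn -IH; last first.
  by move=> z zt; apply: ht; rewrite inE zt orbT.
by have := ht y (mem_head _ _); lia.
Qed.

Lemma length_diffsP (gs : seq nat) (a b n l : nat) : spans_interval gs a b ->
  length_set gs n l <-> l * a <= n /\
  exists s, [/\ {subset s <= diffs a gs}, size s = l & sumn s = n - l * a].
Proof.
case=> _ _ gab; have ga : {in gs, forall y, a <= y} by move=> y /gab/andP[].
split=> [/length_setP[t [ht <- <-]]|[la [s [/subset_map_lift[t ht ->]]]]].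
  have /sumn_diffs E : {in t, forall y, a <= y} by move=> y /ht/ga.
  split; first by lia.
  exists (diffs a t); split; [exact: subset_map_image|by rewrite size_map|by lia].
have /sumn_diffs E : {in t, forall y, a <= y} by move=> y /ht/ga.
rewrite size_map => El Es; apply/length_setP; exists t; split => //.
by move: E Es la; rewrite /diffs El; lia.
Qed.

Lemma length_codiffsP (gs : seq nat) (a b n l : nat) : spans_interval gs a b ->
  length_set gs n l <-> n <= l * b /\
  exists s, [/\ {subset s <= codiffs b gs}, size s = l & sumn s = l * b - n].
Proof.
case=> _ _ gab; have gb : {in gs, forall y, y <= b} by move=> y /gab/andP[].
split=> [/length_setP[t [ht <- <-]]|[lb [s [/subset_map_lift[t ht ->]]]]].
  have /sumn_codiffs E : {in t, forall y, y <= b} by move=> y /ht/gb.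
  split; first by lia.
  exists (codiffs b t); split; [exact: subset_map_image|by rewrite size_map|by lia].
have /sumn_codiffs E : {in t, forall y, y <= b} by move=> y /ht/gb.
rewrite size_map => El Es; apply/length_setP; exists t; split => //.
by move: E Es lb; rewrite /codiffs El; lia.
Qed.

(** The two terms in [l * a * b] cancel, so the weighted sum of the gaps does not depend on [l]; the
    hypotheses keep the subtractions exact. *)
Lemma weighted_gaps (a b l n : nat) : l * a <= n -> n <= l * b ->
  b * (n - l * a) + a * (l * b - n) = (b - a) * n.
Proof.
move=> la lb; rewrite mulnBl !mulnBr.
have : b * (l * a) <= b * n by rewrite leq_mul2l la orbT.
have : a * n <= a * (l * b) by rewrite leq_mul2l lb orbT.
have : a * (l * b) = b * (l * a) by rewrite mulnCA mulnC mulnCA mulnC; lia.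
by move: (b * (l * a)) (a * (l * b)) (b * n) (a * n); clear; lia.
Qed.

(* With x = n - l a and y = l b - n one has x + y = l (b - a) and
   b x + a y = (b - a) n, so that x or y is at least (b - a)^2. *)
Lemma length_of_spans (gs : seq nat) (a b n l : nat) :
  spans_interval gs a b -> a < b -> b ^ 2 - a ^ 2 <= n ->
  l * a <= n -> n <= l * b ->
  seq_span (diffs a gs) (n - l * a) -> seq_span (codiffs b gs) (l * b - n) ->
  length_set gs n l.
Proof.
move=> hgs ab hn la lb hx hy; have [ag bg _] := hgs.
pose D := b - a; have D0 : 0 < D by rewrite subn_gt0.
have Eb : b = a + D by rewrite subnKC // ltnW.
have Exy : (n - l * a) + (l * b - n) = l * D by rewrite Eb mulnDr in lb *; lia.
have DD : D * D.-1 <= D * D by rewrite leq_mul // leq_pred.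
(* By [Exy], a large first gap leaves room [D * D] above the second one, so [l] summands suffice for
   the codifferences. *)
have [xD|xD] := leqP (D * D) (n - l * a).
  apply/(length_codiffsP _ _ hgs); split => //; apply: span_of_length D0 _ _ hy _.
  - by apply/mapP; exists b; rewrite ?subnn.
  - by apply/mapP; exists a.
  - by lia.
have [yD|yD] := leqP (D * D) (l * b - n).
  apply/(length_diffsP _ _ hgs); split => //; apply: span_of_length D0 _ _ hx _.
  - by apply/mapP; exists a; rewrite ?subnn.
  - by apply/mapP; exists b.
  - by lia.
have E := weighted_gaps la lb; rewrite -/D in E.
have F : D * (D * (a + b)) <= D * n.
  by rewrite leq_pmul2l // (leq_trans _ hn) // subn_sqr [a + b]addnC.
have h1 : b * (n - l * a) < b * (D * D) by rewrite ltn_pmul2l //; lia.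
have h2 : a * (l * b - n) <= a * (D * D) by apply: leq_mul => //; exact: ltnW.
have : b * (n - l * a) + a * (l * b - n) < D * (D * (a + b)).
  have -> : D * (D * (a + b)) = b * (D * D) + a * (D * D).
    by rewrite mulnA mulnC -mulnDl addnC.
  by rewrite -addSn leq_add.
by rewrite E ltnNge F.
Qed.

(** * Thresholds for both monoids *)

(** Since [b - z = (b - a) - (z - a)], one [d] serves both monoids. *)
Lemma dvd_codiffs (gs : seq nat) (a b d y : nat) : spans_interval gs a b ->
  (forall y, y \in diffs a gs -> d %| y) -> y \in codiffs b gs -> d %| y.
Proof.
case=> ag bg gab dg /mapP[z zg ->].
have /andP[az zb] := gab z zg.
have -> : b - z = (b - a) - (z - a) by lia.
by rewrite dvdn_sub // dg //; apply: map_f.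
Qed.

Lemma span_of_residue (D : nat) (H s : seq nat) (x : nat) :
  D \in H -> {subset s <= H} -> sumn s = x %[mod D] -> sumn s <= x ->
  seq_span H x.
Proof.
move=> DH hs /esym/eqP; move=> Es le.
move: Es; rewrite eqn_mod_dvd // => /dvdnP[q Eq].
exists (s ++ nseq q D); first by apply: subset_cat => //; exact: subset_nseq.
by rewrite sumn_cat sumn_nseq mulnC -Eq subnKC.
Qed.

(* The two thresholds come from one list T: W is the sum of its elements t, and
   V that of their complements D - t. *)
Lemma joint_conductors (gs : seq nat) (a b e : nat) :
  spans_interval gs a b -> a < b -> b - a = e * foldr gcdn 0 (diffs a gs) ->
  exists W V, [/\ W + V <= (b - a) * e.-1,
    forall x, foldr gcdn 0 (diffs a gs) %| x -> W <= x ->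
      seq_span (diffs a gs) x &
    forall y, foldr gcdn 0 (diffs a gs) %| y -> V <= y ->
      seq_span (codiffs b gs) y].
Proof.
set d := foldr gcdn 0 _; set D := b - a => hgs ab ED.
have D0 : 0 < D by rewrite subn_gt0.
have e0 : 0 < e by move: D0; rewrite ED muln_gt0 => /andP[].
have [ag bg gab] := hgs.
have [T [TH Te TC]] := reaching_list D0 e0 ED.
have TD : {in T, forall t, t <= D}.
  by move=> t /TH/mapP[y /gab/andP[_ yb] ->]; exact: leq_sub2r.
have DT : {subset [seq D - t | t <- T] <= codiffs b gs}.
  move=> _ /mapP[t /TH/mapP[y yg ->] ->]; have /andP[ay yb] := gab y yg.
  by apply/mapP; exists y => //; rewrite /D; lia.
exists (sumn T), (sumn (codiffs D T)); split.
- rewrite addnC sumn_codiffs // mulnC leq_mul2l -ltnS prednK //.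
  by rewrite Te orbT.
- move=> x /TC[s sT Es] Tx; apply: (span_of_residue _ _ Es).
  + by apply/mapP; exists b.
  + by move=> z /(mem_subseq sT)/TH.
  + by apply: leq_trans Tx; exact: sumn_subseq.
(* [D.-1 * y] is [- y] modulo [D]; complementing each summand [t] to [D - t] flips the sign of the
   residue back. *)
- move=> y dy Ty; have [s sT Es] := TC (D.-1 * y) (dvdn_mull _ dy).
  have sD : {in s, forall t, t <= D} by move=> t /(mem_subseq sT)/TD.
  apply: (@span_of_residue D _ (codiffs D s)).
  + by apply/mapP; exists a.
  + by move=> z zs; apply: DT; apply: mem_subseq zs; exact: map_subseq.
  + apply/eqP; rewrite -(eqn_modDr (sumn s)) sumn_codiffs // modnMl.
    by rewrite -modnDmr Es modnDmr -mulSn prednK // modnMr.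
  + by apply: leq_trans Ty; exact/sumn_subseq/map_subseq.
Qed.

(** With [D = d * e] and [b = a + D], the bounds give [D^2 (2a + D) < b D (e - 1) + d a b].
    Replacing [d a^2] by [D (e - 1) a] bounds the right side by [D (2a (e - 1 + d) + D (e - 1))],
    which is at most [D^2 (2a + D)] because [e - 1 + d <= d e]. *)
Lemma conductor_arith (a d e n W V x y : nat) :
  0 < a -> 0 < d -> 0 < e ->
  W + V <= d * e * e.-1 -> d * e * (a + (a + d * e)) <= n ->
  (a + d * e) * x + a * y = d * e * n ->
  (a + d * e) * x + a * y < (a + d * e) * W + a * V + d * a * (a + d * e) ->
  d * a < d * e * e.-1 -> False.
Proof.
move=> a0 d0 e0 hWV hn -> hlt hda.
set D := d * e in hWV hn hlt hda *; have D0 : 0 < D by rewrite muln_gt0 d0.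
have hD : e.-1 + d <= D.
  rewrite /D -{2}(prednK e0) -(prednK d0) mulSn mulnS /=.
  by move: (d.-1 * e.-1); clear; lia.
have hE : a < e * e.-1.
  by move: hda; rewrite /D -mulnA ltn_pmul2l.
have h1 : D * (D * (a + (a + D))) <= D * n by rewrite leq_mul2l hn orbT.
have h2 : (a + D) * W + a * V <= (a + D) * (D * e.-1).
  apply: leq_trans (_ : (a + D) * (W + V) <= _).
    by rewrite mulnDr leq_add2l leq_mul2r leq_addr orbT.
  by rewrite leq_mul2l hWV orbT.
have h3 : d * a * a <= D * e.-1 * a.
  by rewrite leq_mul2r ltnW ?orbT.
have h4 : D * (2 * a) * (e.-1 + d) <= D * (2 * a) * D.
  by rewrite leq_mul2l hD orbT.
have h5 : D * D * e.-1 <= D * D * D.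
  by rewrite leq_mul2l (leq_trans _ hD) ?leq_addr ?orbT.
clearbody D; clear hn hWV hda hE hD; move: (e.-1) (D * n) h1 h2 h3 h4 h5 hlt.
by move=> E N; nia.
Qed.

(** * The extremal lengths *)

(** By Gauss, [d * a] divides [x - y]; this is the period occurring in [A_] and [A'_]. *)
Lemma modn_coprime_diff (a d x y : nat) : coprime d a -> y <= x ->
  x = y %[mod a] -> d %| x -> d %| y -> exists k, x = y + k * d * a.
Proof.
move=> cda yx /eqP Ea dx dy.
have /dvdnP[k Ek] : d * a %| x - y.
  by rewrite Gauss_dvd // dvdn_sub // -eqn_mod_dvd.
by exists k; rewrite -mulnA -Ek subnKC.
Qed.

Lemma gaps_exceed_conductors (a b d e n l W V : nat) :
  0 < a -> a < b -> b - a = e * d -> W + V <= (b - a) * e.-1 ->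
  b ^ 2 - a ^ 2 <= n -> l * a <= n -> n <= l * b ->
  b * (n - l * a) + a * (l * b - n) < b * W + a * V + d * a * b ->
  d * a < W + V -> False.
Proof.
move=> a0 ab ED hWV hn la lb hlt hda.
have [e0 d0] : 0 < e /\ 0 < d.
  by move: ab; rewrite -subn_gt0 ED muln_gt0 => /andP[].
have Eb : b = a + d * e by rewrite mulnC -ED subnKC // ltnW.
have EW : W + V <= d * e * e.-1 by rewrite [d * e]mulnC -ED.
apply: (conductor_arith a0 d0 e0 EW (n := n) (x := n - l * a) (y := l * b - n)).
- by rewrite -Eb mulnC [d * e]mulnC -ED (leq_trans _ hn) // subn_sqr mulnC [a + b]addnC.
- by rewrite -Eb weighted_gaps // ED [e * d]mulnC.
- by rewrite -Eb.
- exact: leq_trans EW.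
Qed.

(** The gap of the known length [l] is [B + k * d * a], so [l + k * d] has gap exactly [B]. Its
    codifference gap is in the span if it is at least [V]; otherwise both gaps are too small for
    [weighted_gaps]. *)
Lemma length_of_min_diff (gs : seq nat) (a b n l B : nat) :
  spans_interval gs a b -> 0 < a -> a < b -> b ^ 2 - a ^ 2 <= n ->
  coprime (foldr gcdn 0 (diffs a gs)) a ->
  length_set gs n l ->
  seq_span (diffs a gs) B -> B = n %[mod a] ->
  (forall x, seq_span (diffs a gs) x -> x = n %[mod a] -> B <= x) ->
  exists2 l0, length_set gs n l0 & n = l0 * a + B.
Proof.
set d := foldr gcdn 0 _ => hgs a0 ab hn cda hl hB EB minB.
have [ag bg gab] := hgs.
have dg y : y \in diffs a gs -> d %| y by exact: dvd_foldr_gcdn.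
have dK y : y \in codiffs b gs -> d %| y by exact: (dvd_codiffs hgs dg).
have /dvdnP[e ED] : d %| b - a by apply: dg; apply: map_f.
have d0 : 0 < d by move: ab; rewrite -subn_gt0 ED muln_gt0 => /andP[].
have [la [s [sH _ Es]]] := (length_diffsP n l hgs).1 hl.
have [lb [t [tH _ Et]]] := (length_codiffsP n l hgs).1 hl.
have hx : seq_span (diffs a gs) (n - l * a) by exists s.
have dy : d %| l * b - n by apply: (dvd_seq_span dK); exists t.
have Ex : n - l * a = n %[mod a].
  by rewrite -[in RHS](subnK la) addnC modnMDl.
have [k Ek] : exists k, n - l * a = B + k * d * a.
  apply: modn_coprime_diff; rewrite ?minB ?Ex ?EB //.
    exact: (dvd_seq_span dg hx).
  exact: (dvd_seq_span dg hB).
have En : n = (l + k * d) * a + B by rewrite mulnDl; lia.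
exists (l + k * d) => //.
case: k Ek En => [|k] Ek En; first by rewrite addn0.
set l0 := l + k.+1 * d in En *.
have Ey : l0 * b - n = (l * b - n) + k.+1 * d * b by rewrite mulnDl addnBAC.
have lb0 : n <= l0 * b by rewrite mulnDl (leq_trans lb) ?leq_addr.
have la0 : l0 * a <= n by rewrite [leqRHS]En leq_addr.
have Bn : n - l0 * a = B by rewrite {1}En addKn.
have [W [V [hWV hW hV]]] := joint_conductors hgs ab ED.
apply: (length_of_spans hgs ab hn la0 lb0); first by rewrite Bn.
apply: hV; first by rewrite Ey dvdn_add // dvdn_mulr // dvdn_mull.
rewrite leqNgt; apply/negP => ltV.
(* Otherwise [B - d * a] is a smaller element of the same class, in the span by the threshold
   [W]. *)
have ltB : B < W + d * a.
  rewrite ltnNge; apply/negP => leB.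
  have daB : d * a <= B by apply: leq_trans leB; exact: leq_addl.
  have da0 : 0 < d * a by rewrite muln_gt0 d0.
  have : B <= B - d * a.
    apply: minB.
      apply: hW; last by rewrite leq_subRL // addnC.
      by rewrite dvdn_sub ?dvdn_mulr //; exact: (dvd_seq_span dg hB).
    by rewrite -EB -[in RHS](subnK daB) addnC modnMDl.
  by rewrite leqNgt ltn_subrL da0 (leq_trans da0 daB).
apply: (gaps_exceed_conductors a0 ab ED hWV hn la0 lb0).
- have hB1 : b * B < b * (W + d * a) by rewrite ltn_pmul2l // (ltn_trans a0).
  have hV1 : a * (l0 * b - n) <= a * V by rewrite leq_mul2l ltnW ?orbT.
  move: hB1 hV1; rewrite Bn mulnDr [b * (d * a)]mulnC.
  by move: (b * B) (b * W) (d * a * b) (a * V) (a * (l0 * b - n)); clear; lia.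
(* The codifference gap, which is below [V], contains a summand [d * b], and [d * b >= d * a]. *)
- apply: leq_trans (leq_addl W V); apply: leq_ltn_trans ltV; rewrite Ey mulSn mulnDl.
  have : d * a <= d * b by rewrite leq_mul2l ltnW ?orbT.
  by move: (l * b - n) (k * d * b) (d * a) (d * b); clear; lia.
Qed.

(** Mirror image of the previous argument: lowering the length by [k * d] brings the codifference
    gap down to [C] and raises the other gap by [k * d * a]. *)
Lemma length_of_min_codiff (gs : seq nat) (a b n l C : nat) :
  spans_interval gs a b -> 0 < a -> a < b -> b ^ 2 - a ^ 2 <= n ->
  coprime (foldr gcdn 0 (diffs a gs)) b ->
  length_set gs n l ->
  seq_span (codiffs b gs) C -> C + n = 0 %[mod b] ->
  (forall y, seq_span (codiffs b gs) y -> y + n = 0 %[mod b] -> C <= y) ->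
  exists2 l0, length_set gs n l0 & n + C = l0 * b.
Proof.
set d := foldr gcdn 0 _ => hgs a0 ab hn cdb hl hC EC minC.
have [ag bg gab] := hgs.
have b0 : 0 < b by exact: ltn_trans ab.
have dg y : y \in diffs a gs -> d %| y by exact: dvd_foldr_gcdn.
have dK y : y \in codiffs b gs -> d %| y by exact: (dvd_codiffs hgs dg).
have /dvdnP[e ED] : d %| b - a by apply: dg; apply: map_f.
have d0 : 0 < d by move: ab; rewrite -subn_gt0 ED muln_gt0 => /andP[].
have [la [s [sH _ Es]]] := (length_diffsP n l hgs).1 hl.
have [lb [t [tH _ Et]]] := (length_codiffsP n l hgs).1 hl.
have hy : seq_span (codiffs b gs) (l * b - n) by exists t.
have dx : d %| n - l * a by apply: (dvd_seq_span dg); exists s.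
have Ey : l * b - n + n = 0 %[mod b] by rewrite subnK // modnMl mod0n.
have [k Ek] : exists k, l * b - n = C + k * d * b.
  apply: modn_coprime_diff; rewrite ?minC //.
  - by apply/eqP; rewrite -(eqn_modDr n) Ey EC.
  - exact: (dvd_seq_span dK hy).
  - exact: (dvd_seq_span dK hC).
(* Keeps [l - k * d] from being truncated: [k * d * b] is at most [l * b]. *)
have kl : k * d <= l by rewrite -(leq_pmul2r b0); lia.
have En : n + C = (l - k * d) * b by rewrite mulnBl; lia.
exists (l - k * d) => //.
case: k Ek En kl => [|k] Ek En kl; first by rewrite subn0.
set l0 := l - k.+1 * d in En *.
have Ex : n - l0 * a = (n - l * a) + k.+1 * d * a.
  have : k.+1 * d * a <= l * a by rewrite leq_mul2r kl orbT.
  by rewrite mulnBl; move: la; move: (l * a) (k.+1 * d * a); clear; lia.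
have la0 : l0 * a <= n by apply: leq_trans la; rewrite leq_mul2r leq_subr orbT.
have lb0 : n <= l0 * b by rewrite -En leq_addr.
have Cn : l0 * b - n = C by rewrite -En addKn.
have [W [V [hWV hW hV]]] := joint_conductors hgs ab ED.
apply: (length_of_spans hgs ab hn la0 lb0); last by rewrite Cn.
apply: hW; first by rewrite Ex dvdn_add // dvdn_mulr // dvdn_mull.
rewrite leqNgt; apply/negP => ltW.
have ltC : C < V + d * b.
  rewrite ltnNge; apply/negP => leC.
  have dbC : d * b <= C by apply: leq_trans leC; exact: leq_addl.
  have db0 : 0 < d * b by rewrite muln_gt0 d0.
  have : C <= C - d * b.
    apply: minC.
      apply: hV; last by rewrite leq_subRL // addnC.
      by rewrite dvdn_sub ?dvdn_mulr //; exact: (dvd_seq_span dK hC).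
    by rewrite -EC -[in RHS](subnK dbC) addnAC -[in RHS]modnDmr modnMl addn0.
  by rewrite leqNgt ltn_subrL db0 (leq_trans db0 dbC).
apply: (gaps_exceed_conductors a0 ab ED hWV hn la0 lb0).
- have hW1 : b * (n - l0 * a) < b * W by rewrite ltn_pmul2l.
  have hC1 : a * C <= a * (V + d * b) by rewrite leq_mul2l ltnW ?orbT.
  move: hW1 hC1; rewrite Cn mulnDr mulnA [a * d]mulnC.
  by move: (b * W) (d * a * b) (a * V) (a * C) (b * (n - l0 * a)); clear; lia.
- apply: leq_trans (leq_addr V W); apply: leq_ltn_trans ltW; rewrite Ex mulSn mulnDl.
  by move: (n - l * a) (k * d * a) (d * a); clear; lia.
Qed.

(** * Minima, the two monoids and the step as defined *)

Lemma set_min_eq (A : set nat) (m : nat) :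
  A m -> (forall x, A x -> m <= x) -> set_min A = m.
Proof.
move=> Am lbm; apply: xget_unique; first by split.
by move=> x [Ax lbx]; apply: anti_leq; apply/andP; split; [exact: lbx|exact: lbm].
Qed.

Lemma set_max_eq (A : set nat) (m : nat) :
  A m -> (forall x, A x -> x <= m) -> set_max A = m.
Proof.
move=> Am ubm; apply: xget_unique; first by split.
by move=> x [Ax ubx]; apply: anti_leq; apply/andP; split; [exact: ubm|exact: ubx].
Qed.

(** Well-ordering: for a nonempty set the default 0 of [xget] does not arise. *)
Lemma set_minP (A : set nat) (x0 : nat) : A x0 ->
  A (set_min A) /\ forall x, A x -> set_min A <= x.
Proof.
move=> Ax0; have exA : exists x, `[< A x >] by exists x0; apply/asboolP.
have [m /asboolP Am minm] := ex_minnP exA.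
suff -> : set_min A = m by split=> // x Ax; apply/minm/asboolP.
by apply: set_min_eq => // x Ax; apply/minm/asboolP.
Qed.

Lemma sumn_filter_neq0 (s : seq nat) : sumn [seq y <- s | y != 0] = sumn s.
Proof. by elim: s => //= -[|y] s IH /=; rewrite IH. Qed.

(** Zero summands do not affect a sum; this reconciles [diffs] and [codiffs] with the generators of
    [S_M] and [S_m]. *)
Lemma seq_span_drop0 (G H : seq nat) (x : nat) :
  {subset H <= G} -> (forall y, y \in G -> y != 0 -> y \in H) ->
  seq_span H x <-> seq_span G x.
Proof.
move=> HG GH; split=> [[s hs <-]|[s hs <-]].
  by exists s => // y /hs/HG.
exists [seq y <- s | y != 0]; last exact: sumn_filter_neq0.
by move=> y; rewrite mem_filter => /andP[y0 /hs/GH]; apply.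
Qed.

Lemma S_M_spanP (gs : seq nat) (x : nat) :
  S_M gs x <-> seq_span (diffs (gen_first gs) gs) x.
Proof.
apply: iff_trans (monoid_genP _ _) _; apply: seq_span_drop0.
  by move=> y /mapP[z zg ->]; apply: map_f; exact: mem_behead.
case: gs => [|a gs] //= y; rewrite inE => /orP[/eqP->|//].
by rewrite subnn.
Qed.

Lemma S_m_spanP (gs : seq nat) (x : nat) :
  S_m gs x <-> seq_span (codiffs (gen_last gs) gs) x.
Proof.
apply: iff_trans (monoid_genP _ _) _; apply: seq_span_drop0.
  by move=> y /mapP[z zg ->]; apply: map_f; exact: mem_take zg.
case/lastP: gs => [|gs b] // y; rewrite /codiffs /gen_last last_rcons size_rcons /=.
rewrite -cats1 take_size_cat // map_cat mem_cat => /orP[//|].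
by rewrite inE subnn => /eqP->.
Qed.

(** Generators are elements of the monoid, so both have the same common divisors; antisymmetry of
    divisibility makes the value of [xget] unique. *)
Lemma step_gcd (gs : seq nat) :
  step gs = foldr gcdn 0 (diffs (gen_first gs) gs).
Proof.
set H := diffs _ _.
have dvdS x : S_M gs x -> foldr gcdn 0 H %| x.
  by move/S_M_spanP; apply: dvd_seq_span => y; exact: dvd_foldr_gcdn.
have great e : (forall x, S_M gs x -> e %| x) -> e %| foldr gcdn 0 H.
  move=> he; have {}he y : y \in H -> e %| y.
    move=> yH; apply: he; apply/S_M_spanP; exists [:: y]; last by rewrite /= addn0.
    by move=> z; rewrite inE => /eqP->.
  elim: H he {dvdS} => [|h H IH] he; first exact: dvdn0.
  rewrite /= dvdn_gcd he ?mem_head //=; apply: IH => y yH.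
  by rewrite he // inE yH orbT.
apply: xget_unique; first by split.
move=> d [dS dG]; apply/eqP; rewrite eqn_dvd great //.
by rewrite dG.
Qed.

(** * The length set as a progression with gaps *)

(** Set bookkeeping in [int]: a point is indexed by its distance [j] from the bottom and [r] from
    the top, unique because [d > 0]. *)
Lemma arith_prog_minus_gapsE (L A A' : nat -> Prop) (d m M : nat) :
  L m -> L M -> 0 < d ->
  (forall l, L l -> exists j r, l = m + j * d /\ M = l + r * d) ->
  (forall l j r, l = m + j * d -> M = l + r * d -> L l <-> ~ A' j /\ ~ A r) ->
  ([set l%:Z%R | l in L] =
  arith_progression m%:Z%R d%:Z%R M%:Z%R `\`
    (affine_image d%:Z%R A' m%:Z%R `|` affine_image (- d%:Z)%R A M%:Z%R))%classic.
Proof.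
move=> Lm LM d0 hL hLA; apply/seteqP; split=> [_ [l Ll <-]|x [[[j Ex] xM] gap]] /=.
  have [j [r [El EM]]] := hL l Ll.
  have [nA' nA] := (hLA l j r El EM).1 Ll.
  split; first by split; [exists j; lia | lia].
  case=> -[t At Et].
    have Etj : d * t = d * j by lia.
    by move/eqP: Etj; rewrite eqn_pmul2l // => /eqP E; rewrite E in At.
  have Etr : d * t = d * r by lia.
  by move/eqP: Etr; rewrite eqn_pmul2l // => /eqP E; rewrite E in At.
(* Since [M] is itself [m + j0 * d], the index from the top is [j0 - j]. *)
have [j0 [r0 [EM _]]] := hL M LM.
have leM : m + j * d <= M by lia.
have jj0 : j <= j0 by rewrite -(leq_pmul2r d0); lia.
exists (m + j * d); last by lia.
apply/(hLA _ j (j0 - j) erefl); first by rewrite mulnBl; have := leq_mul jj0 (leqnn d); lia.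
split=> hA; apply: gap; [left; exists j => //; lia|right].
exists (j0 - j) => //.
have Ej : (j0 - j) * d = j0 * d - j * d by rewrite mulnBl.
have := leq_mul jj0 (leqnn d); lia.
Qed.

(** The extremes satisfy [n = M * a + b1] and [n + c1 = m * b]. Hence the gaps of
    [l = m + j * d = M - r * d] are [b1 + r * d * a] and [c1 + j * d * b], and membership of both in
    the monoids is the criterion for lengths. *)
Lemma length_set_gapsE (gs : seq nat) (a b n i i' : nat) :
  gen_first gs = a -> gen_last gs = b -> spans_interval gs a b ->
  0 < a -> a < b -> b ^ 2 - a ^ 2 <= n ->
  coprime (step gs) a -> coprime (step gs) b -> monoid_gen gs n ->
  n = i %[mod a] -> n = i' %[mod b] ->
  ([set l%:Z%R | l in length_set gs n] =
  arith_progression (min_length gs n)%:Z%R (step gs)%:Z%R (max_length gs n)%:Z%R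
  `\` (affine_image (step gs)%:Z%R (A'_ gs i') (min_length gs n)%:Z%R
       `|` affine_image (- (step gs)%:Z)%R (A_ gs i) (max_length gs n)%:Z%R))%classic.
Proof.
move=> Ea Eb hgs a0 ab hn cda cdb /monoid_genP[s0 s0g s0n] hni hni'.
have Ln0 : length_set gs n (size s0) by apply/length_setP; exists s0.
have lP l : length_set gs n l -> [/\ l * a <= n, n <= l * b,
    S_M gs (n - l * a) & S_m gs (l * b - n)].
  move=> hl.
  have [la [s [sH _ Es]]] := (length_diffsP n l hgs).1 hl.
  have [lb [t [tH _ Et]]] := (length_codiffsP n l hgs).1 hl.
  split=> //; [apply/S_M_spanP; rewrite Ea | apply/S_m_spanP; rewrite Eb].
    by exists s.
  by exists t.
have lI l : l * a <= n -> n <= l * b -> S_M gs (n - l * a) ->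
    S_m gs (l * b - n) -> length_set gs n l.
  move=> la lb /S_M_spanP + /S_m_spanP; rewrite Ea Eb.
  exact: length_of_spans hgs ab hn la lb.
set d := step gs; have Ed : d = foldr gcdn 0 (diffs a gs) by rewrite /d step_gcd Ea.
have [ag bg _] := hgs.
have dg y : y \in diffs a gs -> d %| y by rewrite Ed; exact: dvd_foldr_gcdn.
have d0 : 0 < d.
  have /dvdn_gt0-> // : d %| b - a by apply: dg; apply: map_f.
  by rewrite subn_gt0.
have dS x : S_M gs x -> d %| x.
  by move/S_M_spanP; rewrite Ea; apply: dvd_seq_span.
have [la0 lb0 SM0 Sm0] := lP _ Ln0.
(* The gap of the known length shows that the class is nonempty, so [b1] is a genuine minimum. *)
have /set_minP[[SB EB] minB] :
    (S_M gs `&` [set x | x = i %[mod gen_first gs]])%classic (n - size s0 * a).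
  by split=> //=; rewrite Ea -hni -[in RHS](subnK la0) addnC modnMDl.
rewrite -/(b1 gs i) in SB EB minB; rewrite /= Ea -hni in EB.
have /set_minP[[SC EC] minC] :
    (S_m gs `&` [set x | x + i' = 0 %[mod gen_last gs]])%classic (size s0 * b - n).
  by split=> //=; rewrite Eb -modnDmr -hni' modnDmr subnK // modnMl mod0n.
rewrite -/(c1 gs i') in SC EC minC; rewrite /= Eb -modnDmr -hni' modnDmr in EC.
have cdga : coprime (foldr gcdn 0 (diffs a gs)) a by rewrite -Ed.
have cdgb : coprime (foldr gcdn 0 (diffs a gs)) b by rewrite -Ed.
have [M LM EM] : exists2 M, length_set gs n M & n = M * a + b1 gs i.
  apply: length_of_min_diff hgs a0 ab hn cdga Ln0 _ EB _.
    by move/S_M_spanP: SB; rewrite Ea.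
  move=> x hx Ex; apply: minB; split; last by rewrite /= Ea Ex.
  by apply/S_M_spanP; rewrite Ea.
have [m Lm Em] : exists2 m, length_set gs n m & n + c1 gs i' = m * b.
  apply: length_of_min_codiff hgs a0 ab hn cdgb Ln0 _ EC _.
    by move/S_m_spanP: SC; rewrite Eb.
  move=> y hy Ey; apply: minC; split.
    by apply/S_m_spanP; rewrite Eb.
  by rewrite /= Eb -modnDmr -hni' modnDmr Ey.
have b0 : 0 < b by exact: ltn_trans ab.
have leM l : length_set gs n l -> l <= M.
  move=> /lP[la _ SMl _].
  have : b1 gs i <= n - l * a.
    apply: minB; split=> //=.
    by rewrite Ea -hni -[in RHS](subnK la) addnC modnMDl.
  by rewrite -[l <= M](leq_pmul2r a0); move: EM la; clear; lia.
have lem l : length_set gs n l -> m <= l.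
  move=> /lP[_ lb _ Sml].
  have : c1 gs i' <= l * b - n.
    apply: minC; split=> //=.
    by rewrite Eb -modnDmr -hni' modnDmr subnK // modnMl mod0n.
  by rewrite -[m <= l](leq_pmul2r b0); move: Em lb; clear; lia.
have -> : max_length gs n = M by exact: set_max_eq.
have -> : min_length gs n = m by exact: set_min_eq.
have dvdM l : length_set gs n l -> d %| M - l.
  move=> Ll; have [la _ SMl _] := lP l Ll.
  rewrite -(Gauss_dvdl _ cda) mulnBl.
  have -> : M * a - l * a = n - l * a - b1 gs i by move: EM; clear; lia.
  by rewrite dvdn_sub ?dS.
apply: arith_prog_minus_gapsE => //.
  move=> l Ll; have /dvdnP[r Er] := dvdM l Ll; have /dvdnP[q Eq] := dvdM m Lm.
  exists (q - r), r; move: (leM l Ll) (lem l Ll) Er Eq; rewrite mulnBl.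
  by move: (q * d) (r * d); clear; lia.
move=> l j r El EMl.
have la : l * a <= n by rewrite EM EMl mulnDl -addnA leq_addr.
have lb : n <= l * b by rewrite El mulnDl -Em -addnA leq_addr.
have Ex : n - l * a = b1 gs i + r * d * a.
  by rewrite EM EMl mulnDl -addnA addKn addnC.
have Ey : l * b - n = c1 gs i' + j * d * b.
  by rewrite El mulnDl -Em -addnA addKn.
split=> [/lP[_ _ SMl Sml]|[nA' nA]].
  by split=> -[_]; rewrite ?Ea ?Eb -?Ex -?Ey.
apply: lI => //.
  (* [A_] only records [r >= 1]; for [r = 0] the element is [b1] itself. *)
  rewrite Ex; apply: contrapT => nS; case: r nA nS {EMl Ex} => [|r] nA nS.
    by apply: nS; rewrite !mul0n addn0.
  by apply: nA; split; rewrite ?Ea.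
rewrite Ey; apply: contrapT => nS; case: j nA' nS {El Ey} => [|j] nA' nS.
  by apply: nS; rewrite !mul0n addn0.
by apply: nA'; split; rewrite ?Eb.
Qed.

(** * Coprimality, and the statement for tuples *)

(** A common divisor of the step and [c] divides all differences, hence the first generator, hence
    every generator. *)
Lemma coprime_step_generator (gs : seq nat) (c : nat) :
  c \in gs -> {in gs, forall y, gen_first gs <= y} ->
  (forall e, (forall y, y \in gs -> e %| y) -> e = 1) -> coprime (step gs) c.
Proof.
move=> cg ga gcd1; apply/eqP/gcd1.
have dg y : y \in gs -> gcdn (step gs) c %| y - gen_first gs.
  move=> yg; apply: dvdn_trans (dvdn_gcdl _ _) _; rewrite step_gcd.
  by apply: dvd_foldr_gcdn; apply: map_f.
have ea : gcdn (step gs) c %| gen_first gs.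
  by rewrite -(dvdn_addr _ (dg c cg)) subnK ?ga // dvdn_gcdr.
by move=> y yg; rewrite -(subnK (ga y yg)) dvdn_add // dg.
Qed.

Local Open Scope classical_set_scope.
Local Open Scope ring_scope.

Theorem theorem4p7 (k : nat) (gs : k.-tuple nat)
  (hk : (2 <= k)%N)
  (gs_pos : forall j : 'I_k, (0 < tnth gs j)%N)
  (gs_incr : forall j l : 'I_k, (j < l)%N -> (tnth gs j < tnth gs l)%N)
  (gs_gcd : \big[gcdn/0%N]_(j < k) tnth gs j = 1%N)
  (n : nat) (hnS : monoid_gen gs n)
  (hn : (gen_last gs ^ 2 - gen_first gs ^ 2 <= n)%N)
  (i i' : nat)
  (hi : (i < gen_first gs)%N) (hni : (n = i %[mod gen_first gs])%N)
  (hi' : (i' < gen_last gs)%N) (hni' : (n = i' %[mod gen_last gs])%N) :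
  [set l%:Z | l in length_set gs n] =
  arith_progression (min_length gs n)%:Z (step gs)%:Z (max_length gs n)%:Z
  `\` (affine_image (step gs)%:Z (A'_ gs i') (min_length gs n)%:Z
       `|` affine_image (- (step gs)%:Z) (A_ gs i) (max_length gs n)%:Z).
Proof.
have Egs : size gs = k by exact: size_tuple.
have k0 : (0 < k)%N by exact: ltnW.
have k1 : (k.-1 < k)%N by rewrite prednK.
pose j0 := Ordinal k0; pose j1 := Ordinal k1.
have Ea : gen_first gs = tnth gs j0 by rewrite (tnth_nth 0%N) /= nth0.
have Eb : gen_last gs = tnth gs j1.
  by rewrite (tnth_nth 0%N) /= -[in k.-1]Egs nth_last.
have le_tnth (j l : 'I_k) : (j <= l)%N -> (tnth gs j <= tnth gs l)%N.
  by rewrite leq_eqVlt => /orP[/eqP/val_inj->|/gs_incr/ltnW].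
have hgs : spans_interval gs (gen_first gs) (gen_last gs).
  rewrite Ea Eb; split; rewrite ?mem_tnth // => _ /tnthP[j ->].
  by rewrite !le_tnth //= -ltnS prednK.
have [ag bg gab] := hgs.
have ga : {in gs, forall y, (gen_first gs <= y)%N} by move=> y /gab/andP[].
have gcd1 e : (forall y, y \in (gs : seq nat) -> e %| y)%N -> e = 1%N.
  move=> he; apply/eqP; rewrite -dvdn1 -gs_gcd; apply/dvdn_biggcdP => j _.
  by rewrite he ?mem_tnth.
apply: (length_set_gapsE (a := gen_first gs) (b := gen_last gs)) => //.
- by rewrite Ea.
- by rewrite Ea Eb gs_incr //= -ltnS prednK.
- exact: coprime_step_generator.
- exact: coprime_step_generator.
Qed.
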